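(* Let $Q$ be a real polyhedral group, let $D\subseteq Q$ be a downset, and let $a\in\overline{D}$ be a point in the topological closure of $D$. Then the tangent cone $T_aD$ equals $-Q_\nabla$, the negative cone of shape $\nabla$, for some cocomplex $\nabla$ in $Q_+$.
   Context: A real polyhedral group is a group $Q\cong\mathbb{R}^n$, for some $n$, partially ordered by $q\preceq q'\iff q'-q\in Q_+$, where the positive cone $Q_+$ is an intersection of finitely many closed half-spaces, has trivial unit group, and generates $Q$ as a group. Faces of $Q_+$ are submonoids $\sigma\subseteq Q_+$ with $Q_+\setminus\sigma$ an ideal of the monoid $Q_+$, that is, the usual nonempty faces of the polyhedral cone $Q_+$ (including $\{0\}$ and $Q_+$); $\sigma^\circ$ is the relative interior of $\sigma$. A downset is a subset $D\subseteq Q$ with $D-Q_+=D$. The tangent cone $T_aD$ of a downset $D$ at $a\in Q$ is the set of vectors $v\in-Q_+$ such that $a+\epsilon v\in D$ for all sufficiently small (hence all) real $\epsilon>0$. For a set $\nabla$ of faces of $Q_+$, the cone of shape $\nabla$ is $Q_\nabla=\bigcup_{\sigma\in\nabla}\sigma^\circ$. A cocomplex in $Q_+$ is an upset in the poset of faces of $Q_+$ ordered by inclusion, that is, a set $\nabla$ of faces such that $\sigma\in\nabla$ and $\sigma\subseteq\sigma'$ imply $\sigma'\in\nabla$. (The cocomplex $\nabla$ in the claim is called the shape of $D$ at $a$.) *)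

(* Defs.v *)
From HB Require Import structures.
From mathcomp Require Import all_boot all_order all_algebra.
From mathcomp Require Import all_classical all_reals all_analysis.
Set Implicit Arguments.
Unset Strict Implicit.
Unset Printing Implicit Defensive.
Import Order.TTheory GRing.Theory Num.Theory.
Import numFieldNormedType.Exports.
Local Open Scope classical_set_scope.
Local Open Scope ring_scope.

Section Sets.
Context {R : realType} {n : nat}.
Local Notation Q := 'rV[R]_n.
Implicit Types (S M I A : set Q).

Definition opp_set S : set Q := [set - x | x in S].

Definition submonoid S := addr_closed (mem S).

Definition subgroup S := zmod_closed (mem S).

(* Ideals of a monoid may be empty, so a monoid is a face of itself. *)
Definition ideal_of M I :=
  I `<=` M /\ forall x y, M x -> I y -> I (x + y).

(* The boundary hyperplane need not pass through the origin. *)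
Definition closed_halfspace S :=
  exists (u : Q) (c : R),
    u != 0 /\ S = [set x : Q | c <= \sum_(i < n) u 0 i * x 0 i].

Definition affine_set A :=
  forall (x y : Q) (t : R), A x -> A y -> A ((1 - t) *: x + t *: y).

Definition affine_hull S : set Q := smallest affine_set S.

Definition relative_interior S : set Q :=
  [set x | S x /\ within (affine_hull S) (nbhs x) S].

End Sets.

(* [Qp] is the positive cone of a partial order on the group R^n that makes it
   a real polyhedral group: q <= q' is [Qp (q' - q)], which is reflexive and
   transitive by [positive_submonoid] and antisymmetric by
   [positive_units]. *)
Record real_polyhedral_group {R : realType} {n : nat} (Qp : set 'rV[R]_n) :
    Prop := {
  positive_submonoid : submonoid Qp;
  positive_halfspaces : exists (m : nat) (H : 'I_m -> set 'rV[R]_n),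
    (forall i, closed_halfspace (H i)) /\ Qp = \bigcap_(i in setT) H i;
  positive_units : forall q, Qp q -> Qp (- q) -> q = 0;
  positive_generates : smallest subgroup Qp = setT }.

Section Cones.
Context {R : realType} {n : nat} (Qp : set 'rV[R]_n).
Local Notation Q := 'rV[R]_n.

Definition face (F : set Q) :=
  [/\ F `<=` Qp, submonoid F & ideal_of Qp (Qp `\` F)].

Definition downset (D : set Q) := [set d - q | d in D & q in Qp] = D.

Definition tangent_cone (a : Q) (D : set Q) : set Q :=
  [set v | opp_set Qp v /\ \forall e \near 0^'+, D (a + e *: v)].

Definition cocomplex (nabla : set (set Q)) :=
  nabla `<=` face /\
  forall F F', nabla F -> face F' -> F `<=` F' -> nabla F'.

End Cones.

Definition cone_of_shape {R : realType} {n : nat}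
    (nabla : set (set 'rV[R]_n)) : set 'rV[R]_n :=
  \bigcup_(F in nabla) relative_interior F.

(* Main.v *)
Require Import Defs.
From mathcomp Require Import all_boot all_order all_algebra.
From mathcomp Require Import all_classical all_reals all_analysis.
From mathcomp Require Import lra.
Import Order.TTheory GRing.Theory Num.Theory.
Import numFieldNormedType.Exports.
Local Open Scope classical_set_scope.
Local Open Scope ring_scope.

(** The theorem comes down to comparing elements of the positive cone up to
    scaling: say that [q] dominates [y] when [k *: q - y] lies in the cone for
    some scalar [k], which can then be taken positive.  A step from [a] along
    [- q] ends below a rescaled step along [- y], so a downset that contains the
    short steps along [- y] contains those along [- q]
    ([tangent_cone_dominating]).

    Faces enter because the elements dominated by [q] form a face
    ([face_dominated]) that has [q] in its relative interior
    ([relative_interior_dominated]), while a point in the relative interior of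
    any face dominates all of that face ([relative_interior_dominates]).

    The shape is taken to be the set of faces [F] such that [- q] is tangent for
    some [q] in [F], not necessarily in its relative interior.  This is visibly
    closed under enlarging [F].  A tangent vector [- q] lies in minus the
    relative interior of the face dominated by [q]; conversely, if [y] in [F] has
    [- y] tangent, every point in the relative interior of [F] dominates [y], so
    its opposite is tangent.

    Polyhedrality makes the cone the solution set of finitely many homogeneous
    linear inequalities ([positive_cone_dot]).  Homogeneity gives stability under
    rescaling; finiteness gives a whole neighbourhood of [q] on which the
    inequalities that are strict at [q] persist. *)

(** * Linear inequalities of a polyhedral cone *)

Definition dot {R : realType} {n : nat} (u x : 'rV[R]_n) : R :=
  \sum_(i < n) u 0 i * x 0 i.

Lemma dotD {R : realType} {n : nat} (u x y : 'rV[R]_n) :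
  dot u (x + y) = dot u x + dot u y.
Proof.
by rewrite /dot -big_split; apply: eq_bigr => i _; rewrite mxE mulrDr.
Qed.

Lemma dotZ {R : realType} {n : nat} (u x : 'rV[R]_n) (t : R) :
  dot u (t *: x) = t * dot u x.
Proof.
by rewrite /dot mulr_sumr; apply: eq_bigr => i _; rewrite mxE mulrCA.
Qed.

Lemma dotB {R : realType} {n : nat} (u x y : 'rV[R]_n) :
  dot u (x - y) = dot u x - dot u y.
Proof. by rewrite dotD -scaleN1r dotZ mulN1r. Qed.

Lemma dot_continuous {R : realType} {n : nat} (u : 'rV[R]_n) :
  continuous (dot u).
Proof.
apply: continuous_big => [|i _ x]; first exact: add_continuous.
by apply: continuousM; [exact: cst_continuous | exact: coord_continuous].
Qed.

Lemma submonoidP {R : realType} {n : nat} (S : set 'rV[R]_n) :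
  submonoid S <-> S 0 /\ (forall x y, S x -> S y -> S (x + y)).
Proof.
split=> [[S0 SD]|[S0 SD]]; split.
- by move: S0; rewrite inE.
- by move=> x y Sx Sy; have := SD x y; rewrite !inE; apply.
- by rewrite inE.
- by move=> x y; rewrite !inE; exact: SD.
Qed.

(** A half-space that contains a monoid also contains it after its boundary is
    moved to the origin: all multiples of a point of the monoid satisfy the same
    lower bound, so the linear form is nonnegative there. *)
Lemma positive_cone_dot {R : realType} {n : nat} (Qp : set 'rV[R]_n) :
  real_polyhedral_group Qp ->
  exists (m : nat) (u : 'I_m -> 'rV[R]_n),
    Qp = [set x | forall i, 0 <= dot (u i) x].
Proof.
case=> /submonoidP[Q0 QD] [m [H [Hhalf QE]]] _ _.
have /choice[u Hu] : forall i, exists u : 'rV[R]_n,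
    exists c, H i = [set x | c <= dot u x].
  by move=> i; have [u [c [_ ->]]] := Hhalf i; exists u, c.
exists m, u; apply/seteqP; split=> x /=.
- move=> Qx i; have [c Hc] := Hu i.
  have Qk k : Qp (x *+ k) by elim: k => [//|k IHk]; rewrite mulrS; exact: QD.
  have ck k : c <= dot (u i) x *+ k.
    have : H i (x *+ k) by move: (Qk k); rewrite QE; apply.
    by rewrite Hc /= -scaler_nat dotZ mulr_natl.
  rewrite leNgt; apply/negP => ux_lt0.
  have [k] : exists k, - c < (- dot (u i) x) *+ k.
    exists (Num.bound (`|c| / - dot (u i) x)).
    rewrite -mulr_natl (le_lt_trans (ler_norm _)) // normrN.
    rewrite -ltr_pdivrMr ?oppr_gt0 //; apply: archi_boundP.
    by rewrite divr_ge0 // oppr_ge0 ltW.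
  by have := ck k; rewrite mulNrn; lra.
- move=> ux; rewrite QE => i _; have [c Hc] := Hu i.
  have : H i 0 by move: Q0; rewrite QE; apply.
  rewrite Hc /= -[0 in X in X -> _](scale0r x) dotZ mul0r => c_le0.
  exact: le_trans c_le0 (ux i).
Qed.

Lemma positive_coneZ {R : realType} {n : nat} (Qp : set 'rV[R]_n)
    (t : R) (x : 'rV[R]_n) :
  real_polyhedral_group Qp -> 0 <= t -> Qp x -> Qp (t *: x).
Proof.
move=> /positive_cone_dot[m [u ->]] t0 /= ux i.
by rewrite dotZ mulr_ge0.
Qed.

(** * The face of elements dominated by a point *)

Definition dominated {R : realType} {n : nat} (Qp : set 'rV[R]_n)
    (q : 'rV[R]_n) : set 'rV[R]_n :=
  [set y | Qp y /\ exists k : R, Qp (k *: q - y)].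

(** Bounds [k *: q] add up, and a summand of a dominated element is bounded by
    the same multiple of [q]. *)
Lemma face_dominated {R : realType} {n : nat} (Qp : set 'rV[R]_n)
    (q : 'rV[R]_n) :
  submonoid Qp -> face Qp (dominated Qp q).
Proof.
move=> /submonoidP[Q0 QD]; split.
- by move=> y [].
- apply/submonoidP; split; first by split=> //; exists 0; rewrite scale0r subr0.
  move=> x y [Qx [k Qkx]] [Qy [l Qly]]; split; first exact: QD.
  by exists (k + l); rewrite scalerDl opprD addrACA; exact: QD.
- split=> [y []//|x y Qx [Qy yNdom]]; split; first exact: QD.
  move=> [_ [k Qk]]; apply: yNdom; split=> //; exists k.
  have -> : k *: q - y = x + (k *: q - (x + y)) by rewrite opprD addrCA addNKr.
  exact: QD.
Qed.

Lemma dominated_refl {R : realType} {n : nat} (Qp : set 'rV[R]_n)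
    (q : 'rV[R]_n) :
  submonoid Qp -> Qp q -> dominated Qp q q.
Proof.
by move=> /submonoidP[Q0 _] Qq; split=> //; exists 1; rewrite scale1r subrr.
Qed.

(** The linear forms that vanish at [q] vanish on everything that [q] dominates,
    hence on the affine hull, and the others stay positive near [q].  A point [y]
    of the hull near [q] therefore lies in the cone, and so does its reflection
    [2 *: q - y], which witnesses that [q] dominates [y]. *)
Lemma relative_interior_dominated {R : realType} {n : nat}
    (Qp : set 'rV[R]_n) (q : 'rV[R]_n) :
  real_polyhedral_group Qp -> Qp q ->
  relative_interior (dominated Qp q) q.
Proof.
move=> hQ Qq; split.
  by apply: dominated_refl => //; exact: positive_submonoid hQ.
have [m [u QE]] := positive_cone_dot Qp hQ.
have hull_tight i y : affine_hull (dominated Qp q) y ->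
    dot (u i) q = 0 -> dot (u i) y = 0.
  move=> hy uq0; apply: (hy [set z | dot (u i) z = 0]); split.
  - by move=> x z t /= ux uz; rewrite dotD !dotZ ux uz !mulr0 addr0.
  - rewrite QE => z [/= uz [k /(_ i)]]; rewrite dotB dotZ uq0 mulr0 sub0r.
    by have := uz i; lra.
have uq i : 0 <= dot (u i) q by move: Qq; rewrite QE; apply.
have near_slack : \forall y \near q, forall i, 0 < dot (u i) q ->
    0 < dot (u i) y < 2 * dot (u i) q.
  apply: (filter_forall (F := nbhs q)) => i.
  have [uq_gt0|] := ltP 0 (dot (u i) q); last by move=> _; exact: nearW.
  have /cvgr_dist_lt/(_ _ uq_gt0) := dot_continuous (u i) q.
  apply: filterS => y; rewrite ltr_distl => uy _.
  by move: uy; lra.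
rewrite /within /=; near=> y => hy.
have slack : forall i, 0 < dot (u i) q ->
    0 < dot (u i) y < 2 * dot (u i) q by near: y.
have uy i : 0 <= dot (u i) y <= 2 * dot (u i) q.
  have := uq i; rewrite le_eqVlt => /orP[/eqP uq0|/slack]; last by lra.
  by rewrite (hull_tight i y hy) // -uq0 mulr0 lexx.
split; first by rewrite QE => i; case/andP: (uy i).
by exists 2; rewrite QE => i; rewrite dotB dotZ subr_ge0; case/andP: (uy i).
Unshelve. all: by end_near. Qed.

(** From [q] in the relative interior, the line through [y] and [q] can be
    prolonged slightly beyond [q] without leaving [F]; rescaling the endpoint
    [q + e *: (q - y)] gives a multiple of [q] minus [y]. *)
Lemma relative_interior_dominates {R : realType} {n : nat}
    (Qp F : set 'rV[R]_n) (q y : 'rV[R]_n) :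
  real_polyhedral_group Qp -> F `<=` Qp -> relative_interior F q -> F y ->
  exists2 k : R, 0 < k & Qp (k *: q - y).
Proof.
move=> hQ FQ [Fq Fnear] Fy.
have near_ray : (fun e : R => q + e *: (q - y)) @ 0^'+ --> q.
  rewrite -[X in _ --> X]addr0; apply: cvgD; first exact: cvg_cst.
  rewrite -(scale0r (q - y)); apply: cvgZr_tmp.
  exact: cvg_at_right_filter cvg_id.
have [e [e0 Fe]] : exists e : R,
    0 < e /\ (affine_hull F (q + e *: (q - y)) -> F (q + e *: (q - y))).
  apply: (@filter_ex _ (0 : R)^'+).
  near=> e; split; first by near: e; exact: nbhs_right_gt.
  by near: e; exact: near_ray Fnear.
have hull_ray : affine_hull F (q + e *: (q - y)).
  move=> A [Aaff FA].
  have -> : q + e *: (q - y) = (1 - - e) *: q + (- e) *: y.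
    by rewrite opprK scalerDl scale1r scalerBr scaleNr addrA.
  by apply: Aaff; exact: FA.
exists (e^-1 + 1); first by rewrite addr_gt0 ?invr_gt0.
have -> : (e^-1 + 1) *: q - y = e^-1 *: (q + e *: (q - y)).
  by rewrite scalerDr scalerA mulVf ?gt_eqF // scale1r scalerDl scale1r addrA.
apply: positive_coneZ => //; first by rewrite invr_ge0 ltW.
exact/FQ/Fe.
Unshelve. all: by end_near. Qed.

(** * Tangent cones of downsets *)

(** The step [e] along [- q] lands below the step [e / k] along [- y], since
    their difference is [e / k] times [k *: q - y]. *)
Lemma tangent_cone_dominating {R : realType} {n : nat} (Qp : set 'rV[R]_n)
    (D : set 'rV[R]_n) (a q y : 'rV[R]_n) (k : R) :
  real_polyhedral_group Qp -> downset Qp D -> Qp q -> 0 < k ->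
  Qp (k *: q - y) -> tangent_cone Qp a D (- y) -> tangent_cone Qp a D (- q).
Proof.
move=> hQ hD Qq k0 Qkqy [_ Dy]; split; first by exists q.
case: Dy => r /= r0 Dr.
near=> e.
have e0 : 0 < e by near: e; exact: nbhs_right_gt.
have Dstep : D (a + (e / k) *: - y).
  apply: Dr; last exact: divr_gt0.
  rewrite /= sub0r normrN gtr0_norm ?divr_gt0 // ltr_pdivrMr //.
  by near: e; apply: nbhs_right_lt; exact: mulr_gt0.
rewrite -hD; exists (a + (e / k) *: - y) => //.
exists ((e / k) *: (k *: q - y)).
  by apply: positive_coneZ => //; rewrite ltW ?divr_gt0.
by rewrite scalerBr scalerA divfK ?gt_eqF // !scalerN opprB addrA subrK.
Unshelve. all: by end_near. Qed.

Theorem proposition6p10 (R : realType) (n : nat) (Qp : set 'rV[R]_n)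
    (hQ : real_polyhedral_group Qp) (D : set 'rV[R]_n) (hD : downset Qp D)
    (a : 'rV[R]_n) (ha : closure D a) :
  exists nabla : set (set 'rV[R]_n),
    cocomplex Qp nabla /\
    tangent_cone Qp a D = opp_set (cone_of_shape nabla).
Proof.
exists [set F | face Qp F /\ exists2 y, F y & tangent_cone Qp a D (- y)].
split.
  split=> [F []//|F F' [_ [y Fy Ty]] faceF' FF'].
  by split=> //; exists y => //; exact: FF'.
apply/seteqP; split=> v.
- move=> Tv; have [[q Qq qv] _] := Tv; rewrite -qv in Tv *.
  have hM := positive_submonoid hQ.
  exists q => //; exists (dominated Qp q).
    split; first exact: face_dominated.
    by exists q => //; exact: dominated_refl.
  exact: relative_interior_dominated.
- move=> [q [F [[FQ _ _] [y Fy Ty]] riq] <-].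
  have [k k0 Qkqy] := relative_interior_dominates Qp F q y hQ FQ riq Fy.
  by apply: tangent_cone_dominating Qkqy Ty => //; apply: FQ; case: riq.
Qed.
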